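(* Let $s\in(-1,\infty)$ and let $f$ be an $s$-concave probability density on $\mathbb{R}$ (with respect to Lebesgue measure), with distribution function $F(x)=\int_{-\infty}^x f(t)\,dt$. Then $F$ is bi-$s^*$-concave for every real $s^*\le s/(1+s)$.
   Context: A density $f:\mathbb{R}\to[0,\infty)$ is $s$-concave if: for $s<0$, $f^s$ is convex as a function from $\mathbb{R}$ to $(0,\infty]$ (with $0^s=\infty$); for $s=0$, $\log f$ is concave as a function from $\mathbb{R}$ to $[-\infty,\infty)$; for $s>0$, the set $\{f>0\}$ is convex and $f^s$ is concave on $\{f>0\}$. For a distribution function $F$ on $\mathbb{R}$ let $J(F)=\{x\in\mathbb{R}:0<F(x)<1\}$. For $s^*\in(-\infty,1]$, $F$ is bi-$s^*$-concave if $F$ is continuous on $\mathbb{R}$ and, on $J(F)$: for $s^*<0$, both $F^{s^*}$ and $(1-F)^{s^*}$ are convex; for $s^*=0$, both $\log F$ and $\log(1-F)$ are concave; for $0<s^*\le 1$, both $F^{s^*}$ and $(1-F)^{s^*}$ are concave. (Note that $s/(1+s)<1$ for $s\in(-1,\infty)$.) *)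

(* Defs.v *)
From HB Require Import structures.
From mathcomp Require Import all_boot all_order all_algebra.
From mathcomp Require Import all_classical all_reals all_analysis.

Set Implicit Arguments.
Unset Strict Implicit.
Unset Printing Implicit Defensive.

Import Order.TTheory GRing.Theory Num.Theory.
Import numFieldNormedType.Exports.

Local Open Scope classical_set_scope.
Local Open Scope ring_scope.

Definition probability_density (R : realType) (f : R -> R) : Prop :=
  [/\ measurable_fun [set: R] f,
      (forall x, 0 <= f x)
    & (\int[@lebesgue_measure R]_(x in [set: R]) (f x)%:E = 1)%E].

Definition distribution_function (R : realType) (f : R -> R) (x : R) : R :=
  \int[@lebesgue_measure R]_(t in `]-oo, x]) f t.

Definition concave_function (R : realType) (D : set R) (f : R -> R) : Prop :=
  @convex_function R R^o D (fun x => - f x).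

(* Meant for g that never takes the value -oo, so that the right-hand side is
   never of the form +oo - oo; by the library's convention 0 * +oo = 0, the
   inequality is trivial for t = 0 and t = 1. *)
Definition econvex_function (R : realType) (g : R -> \bar R) : Prop :=
  forall (t : {i01 R}) (x y : R),
    (g (t%:num * x + (1 - t%:num) * y)%R <=
       t%:num%:E * g x + (1 - t%:num)%:E * g y)%E.

Definition econcave_function (R : realType) (g : R -> \bar R) : Prop :=
  econvex_function (fun x => - g x)%E.

(* y |-> y ^ s on [0, +oo[ for s < 0, with 0 ^ s = +oo (whereas powR 0 s = 0) *)
Definition neg_powR (R : realType) (y s : R) : \bar R :=
  if y == 0 then +oo%E else (y `^ s)%:E.

(* lne is the logarithm with lne 0 = -oo. *)
Definition s_concave (R : realType) (s : R) (f : R -> R) : Prop :=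
  [/\ s < 0 -> econvex_function (fun x => neg_powR (f x) s),
      s = 0 -> econcave_function (fun x => lne (f x)%:E)
    & 0 < s -> @convex_set R R^o [set x | 0 < f x] /\
               concave_function [set x | 0 < f x] (fun x => f x `^ s)].

Definition Jset (R : realType) (F : R -> R) : set R := [set x | 0 < F x < 1].

(* Used for s <= 1 only. On Jset F both F and 1 - F are positive, so that powR
   and ln are the usual power and logarithm there. *)
Definition bi_s_concave (R : realType) (s : R) (F : R -> R) : Prop :=
  [/\ continuous F,
      s < 0 ->
        @convex_function R R^o (Jset F) (fun x => F x `^ s) /\
        @convex_function R R^o (Jset F) (fun x => (1 - F x) `^ s),
      s = 0 ->
        concave_function (Jset F) (fun x => ln (F x)) /\
        concave_function (Jset F) (fun x => ln (1 - F x))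
    & 0 < s ->
        concave_function (Jset F) (fun x => F x `^ s) /\
        concave_function (Jset F) (fun x => (1 - F x) `^ s)].

(* Main.v *)
From HB Require Import structures.
Require Import Defs.
From mathcomp Require Import all_boot all_order all_algebra.
From mathcomp Require Import all_classical all_reals all_analysis.
From mathcomp Require Import measurable_realfun.
From mathcomp Require Import ring lra.

(* Let x < y with 0 < f x <= f y and c = f y / f x. The affine map
   T u = y + c ^ s * (u - x) sends ]-oo, x] onto ]-oo, y], and s-concavity gives
   f (T u) >= c * f u for u <= x. Changing variables yields
   F y >= c ^ (1 + s) * F x, hence f * F ^ (p - 1) is nonincreasing on J(F) for
   p <= s / (1 + s); by reflection f * (1 - F) ^ (p - 1) is nondecreasing.
   These two monotonicities squeeze f near any point of J(F), so f is continuous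
   there and F' = f. They then say precisely that the derivatives of F ^ p and
   (1 - F) ^ p (of the logarithms if p = 0) are monotone. *)

Set Implicit Arguments.
Unset Strict Implicit.
Unset Printing Implicit Defensive.

Import Order.TTheory GRing.Theory Num.Theory.
Import numFieldNormedType.Exports.

Local Open Scope classical_set_scope.
Local Open Scope ring_scope.

(** * Affine changes of variables in Lebesgue integrals *)

Section change_of_variables.
Context {R : realType}.
Local Notation mu := (@lebesgue_measure R).

Let affine (c d : R) : measurableTypeR R -> measurableTypeR R :=
  fun x => c * x + d.

Let measurable_affine (c d : R) : measurable_fun setT (affine c d).
Proof. by apply: measurable_funD => //; exact: mulrl_measurable. Qed.

Let affine_image_measure (c d : R) :
    {measure set (measurableTypeR R) -> \bar R} :=
  @measure_function_pushforward__canonical__measure_function_Measure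
    _ _ _ _ _ mu (affine c d) (measurable_affine c d).

(** The preimage of []a, b]] under [affine c d] has length [(b - a) / c], and a measure giving every
    half-open interval its length is Lebesgue measure. *)
Let lebesgue_measure_affine (c d : R) (c0 : 0 < c) (A : set R) :
  measurable A ->
  mu A = mscale (NngNum (ltW c0)) (affine_image_measure c d) A.
Proof.
move=> mA; apply: lebesgue_measure_unique => //= _ [[a b]] _ <-.
rewrite /mscale /= /pushforward.
have -> : affine c d @^-1` `]a, b] = `](a - d) / c, (b - d) / c]%classic.
  apply/seteqP; split => x /=; rewrite !in_itv /= ltr_pdivrMr // ler_pdivlMr //;
    by rewrite !(mulrC x) ltrBlDr lerBrDr.
rewrite !lebesgue_measure_itv /= !lte_fin ltr_pM2r ?invr_gt0 // ltrD2r.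
case: ifPn => _; last by rewrite mule0.
by rewrite -EFinM -mulrBl mulrCA divff ?gt_eqF// mulr1 opprB addrA subrK.
Qed.

Lemma ge0_integral_affineNy (f : R -> \bar R) (c d x : R) : 0 < c ->
  measurable_fun [set: R] f -> (forall r, 0 <= f r)%E ->
  (\int[mu]_(t in `]-oo, (c * x + d)%R]) f t =
   c%:E * \int[mu]_(t in `]-oo, x]) f (c * t + d)%R)%E.
Proof.
move=> c0 mf f0.
have mfD D : measurable_fun D f by exact: measurable_funS mf.
transitivity (\int[mscale (NngNum (ltW c0)) (affine_image_measure c d)]_(t in
    `]-oo, (c * x + d)%R]) f t)%E.
  by apply: eq_measure_integral => A mA _; exact: lebesgue_measure_affine.
rewrite ge0_integral_mscale //; last exact: mfD.
congr (_ * _)%E.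
rewrite [LHS](ge0_integral_pushforward (measurable_affine c d)) //=;
  last exact: mfD.
congr integral; apply/seteqP; split => t /=;
  by rewrite !in_itv /= lerD2r ler_pM2l.
Qed.

Lemma ge0_integral_oppr (D : set R) (f : R -> \bar R) : measurable D ->
  measurable_fun D f -> {in D, forall r, 0 <= f r}%E ->
  (\int[mu]_(t in D) f t =
   \int[mu]_(t in (-%R : _ -> measurableTypeR R) @^-1` D) f (- t)%R)%E.
Proof.
move=> mD mf f0; rewrite -[RHS]ge0_integral_pushforward //=.
by apply: eq_measure_integral => //= A mA _; exact/esym/lebesgue_measureN.
Qed.

End change_of_variables.

(** * One convexity inequality for all signs of s *)

Section concavity_generator.
Context {R : realType}.
Implicit Types (f : R -> R) (s : R).

(* Decreasing in y > 0, so that s-concavity of f reads: {f > 0} is convex and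
   generator s \o f is convex on it, whatever the sign of s. *)
Definition generator s (y : R) : R :=
  if s == 0 then - ln y else - (Num.sg s * y `^ s).

(** For s > 0, positivity at [z] is convexity of the support. For s <= 0, a zero of [f] at [z] would
    make the left side of the inequality infinite while the right side is finite. *)
Lemma s_concave_conv s f : (forall x, 0 <= f x) -> s_concave s f ->
  forall (t : {i01 R}) (x y : R), 0 < f x -> 0 < f y ->
  let z := t%:num * x + (1 - t%:num) * y in
  0 < f z /\
  generator s (f z) <=
    t%:num * generator s (f x) + (1 - t%:num) * generator s (f y).
Proof.
move=> f0 [fneg fzero fpos] t x y fx fy z; rewrite /generator.
have [s0|s0|s0] := ltgtP s 0.
- have := fneg s0 t x y; rewrite -/z /neg_powR (gt_eqF fx) (gt_eqF fy).
  have [_|fz] := eqVneq (f z) 0; first by rewrite -!EFinM -EFinD leye_eq.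
  rewrite -!EFinM -EFinD lee_fin ltr0_sg // !mulN1r !opprK.
  by rewrite lt_neqAle eq_sym fz f0.
- have [cvx cnc] := fpos s0; split.
    have := cvx x y t; rewrite !inE /= /conv /=.
    by move=> /(_ fx fy).
  have := cnc t x y; rewrite !inE /= => /(_ fx fy).
  by rewrite /conv /= !(gtr0_sg s0) !mul1r.
- have := fzero s0 t x y; rewrite -/z !(lne_EFin fx) !(lne_EFin fy).
  rewrite -!EFinN -!EFinM -EFinD; have [fz|fz] := ltP 0 (f z).
    by rewrite lne_EFin // -EFinN lee_fin.
  by rewrite le0_lneNy ?lee_fin //= leye_eq.
Qed.

Lemma s_concave_chord s f (a b c : R) :
  (forall x, 0 <= f x) -> s_concave s f ->
  a <= b <= c -> a < c -> 0 < f a -> 0 < f c ->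
  0 < f b /\
  (c - a) * generator s (f b) <=
    (c - b) * generator s (f a) + (b - a) * generator s (f c).
Proof.
move=> f0 sf /andP[ab bc] ac fa fc.
have ca : 0 < c - a by rewrite subr_gt0.
have t01 : 0 <= (c - b) / (c - a) <= 1.
  by rewrite divr_ge0 ?subr_ge0 ?(ltW ac)//= ler_pdivrMr // mul1r lerB.
have [t0 t1] := andP t01.
have := s_concave_conv f0 sf (Itv01 t0 t1) fa fc => /=.
have -> : (c - b) / (c - a) * a + (1 - (c - b) / (c - a)) * c = b.
  by field; rewrite gt_eqF.
move=> [fb le_b]; split => //.
rewrite -(ler_pM2l ca) in le_b; apply: (le_trans le_b).
rewrite le_eqVlt; apply/orP; left; apply/eqP.
by field; rewrite gt_eqF.
Qed.

Lemma ler_generator s (x y : R) : 0 < x -> 0 < y ->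
  (generator s x <= generator s y) = (y <= x).
Proof.
move=> x0 y0; rewrite /generator.
have lnle (p q : R) : 0 < p -> 0 < q -> (p <= q) = (ln p <= ln q).
  by move=> p0 q0; rewrite ler_ln.
have [s0|s0|s0] := ltgtP s 0.
- rewrite ltr0_sg // !mulN1r !opprK (lnle (x `^ s) (y `^ s)) ?powR_gt0 //.
  by rewrite !ln_powR ler_nM2l // -lnle.
- rewrite gtr0_sg // !mul1r lerN2 (lnle (y `^ s) (x `^ s)) ?powR_gt0 //.
  by rewrite !ln_powR ler_pM2l // -lnle.
- by rewrite lerN2 -lnle.
Qed.

(** This homogeneity is the source of the slope c ^ s of the map T: scaling a density value by c
    scales its generator by c ^ s. *)
Lemma generatorM s (x y : R) : s != 0 -> 0 < x -> 0 < y ->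
  generator s (x * y) = x `^ s * generator s y.
Proof.
move=> s0 x0 y0; rewrite /generator (negbTE s0) powRM ?ltW //.
by rewrite mulrN mulrCA.
Qed.

(* Comparing the chord over [u, y] with the values at x and at the image of u;
   the image lies in [u, y], for s > 0 because f ^ s is positive and concave. *)
Lemma s_concave_affine_transport s f (u x y : R) :
  (forall x, 0 <= f x) -> s_concave s f ->
  u <= x -> x < y -> 0 < f x -> f x <= f y ->
  f y / f x * f u <= f (y + (f y / f x) `^ s * (u - x)).
Proof.
move=> f0 sf; rewrite le_eqVlt => /predU1P[<- _ fx _|ux xy fx fxy].
  by rewrite subrr mulr0 addr0 divfK // gt_eqF.
have [fu0|fu] := eqVneq (f u) 0; first by rewrite fu0 mulr0.
have {fu} fu : 0 < f u by rewrite lt_neqAle eq_sym fu f0.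
have fy : 0 < f y := lt_le_trans fx fxy.
set c := f y / f x.
have c0 : 0 < c by rewrite divr_gt0.
have c1 : 1 <= c by rewrite ler_pdivlMr // mul1r.
have fyE : f y = c * f x by rewrite divfK // gt_eqF.
have uy : u < y := lt_trans ux xy.
have uxy : u <= x <= y by rewrite !ltW.
have [_ chord_x] := s_concave_chord f0 sf uxy uy fu fy.
have cu : 0 < c * f u by rewrite mulr_gt0.
have [s0|s0] := eqVneq s 0.
(* For s = 0 the map is a translation, and multiplying a value by [c] shifts its generator by
   [- ln c] instead of scaling it. *)
- rewrite s0 powRr0 mul1r.
  have uv : u <= y + (u - x) <= y by lra.
  have [fv chord_v] := s_concave_chord f0 sf uv uy fu fy.
  rewrite -(ler_generator s) //.
  have gM (z : R) : 0 < z -> generator s (c * z) = generator s z - ln c.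
    by move=> z0; rewrite /generator s0 eqxx lnM ?posrE // opprD addrC.
  rewrite gM // -(@ler_pM2l _ (y - u)) ?subr_gt0 //.
  move: chord_x chord_v; rewrite fyE gM //; nra.
- set l := c `^ s.
  have l0 : 0 < l by rewrite powR_gt0.
  rewrite fyE generatorM // -/l in chord_x.
  have uv : u <= y + l * (u - x).
    (* If s < 0, then c >= 1 gives l <= 1 and the image is at least y - (x - u) >= u. If s > 0,
       generators are negative; an image left of [u] would mean y - u < l * (x - u), so (y - u - l *
       (x - u)) * generator s (f x) would be positive, yet [chord_x] bounds it by a negative
       number. *)
    case: (ltP s 0) => sgn.
      have : l <= 1 by rewrite -(powRr0 c) ler_powR // ltW.
      nra.
    have {sgn} sgn : 0 < s by rewrite lt_neqAle eq_sym s0.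
    have gneg (z : R) : 0 < z -> generator s z < 0.
      move=> z0; rewrite /generator (negbTE s0) gtr0_sg // mul1r oppr_lt0.
      by rewrite powR_gt0.
    rewrite leNgt; apply/negP => vu.
    have gx := gneg _ fx; have gu := gneg _ fu.
    have : (y - x) * generator s (f u) < 0 by rewrite pmulr_rlt0 // subr_gt0.
    nra.
  have vy : y + l * (u - x) <= y by nra.
  have uvy : u <= y + l * (u - x) <= y by rewrite uv.
  have [fv chord_v] := s_concave_chord f0 sf uvy uy fu fy.
  rewrite -(ler_generator s) //.
  rewrite generatorM // -/l -(@ler_pM2l _ (y - u)) ?subr_gt0 //.
  apply: (le_trans chord_v).
  rewrite fyE generatorM // -/l.
  (* With v the image of [u], y - v = l * (x - u), so the remaining inequality is [chord_x]
     multiplied by [l]. *)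
  have := ler_wpM2l (ltW l0) chord_x.
  lra.
Qed.

End concavity_generator.

(** * Distribution functions and reflection of densities *)

Section density.
Context {R : realType}.
Local Notation mu := (@lebesgue_measure R).
Variable f : R -> R.
Hypothesis f_density : probability_density f.
Local Notation F := (distribution_function f).

Let f_ge0 x : 0 <= f x. Proof. by case: f_density. Qed.

Lemma probability_density_integrable (D : set R) :
  measurable D -> mu.-integrable D (EFin \o f).
Proof.
move=> mD; apply: (@integrableS _ _ _ _ setT) => //; apply/integrableP; split.
  by apply/measurable_EFinP; case: f_density.
case: f_density => _ _ f1; under eq_integral do rewrite /= ger0_norm //.
by rewrite f1 ltry.
Qed.

Lemma distribution_functionE x :
  (F x)%:E = (\int[mu]_(t in `]-oo, x]) (f t)%:E)%E.
Proof.
rewrite /distribution_function /Rintegral fineK // integrable_fin_num //.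
exact: probability_density_integrable.
Qed.

Lemma distribution_functionB (x y : R) : x <= y ->
  F y - F x = \int[mu]_(t in `]x, y]) f t.
Proof.
move=> xy; apply: Rintegral_itvB; rewrite ?bnd_simp //.
exact: probability_density_integrable.
Qed.

Lemma nondecreasing_distribution_function : {homo F : x y / x <= y}.
Proof.
move=> x y xy; rewrite -subr_ge0 distribution_functionB //.
by apply: Rintegral_ge0.
Qed.

Lemma distribution_function_onem (x : R) :
  1 - F x = \int[mu]_(t in `]x, +oo[) f t.
Proof.
rewrite -(@Rintegral_itvB _ f -oo%O +oo%O x) ?bnd_simp //;
  last exact: probability_density_integrable.
congr (_ - _); rewrite set_itvNyy /Rintegral.
by case: f_density => _ _ ->.
Qed.

(** Absolute continuity of the integral: [f] has integral below [e] over any set of measure below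
    some [d], in particular over the interval between two close points. *)
Lemma continuous_distribution_function : continuous F.
Proof.
move=> x; apply/cvgrPdist_lt => e e0.
have [d [d0 small]] :=
  integral_normr_continuous (probability_density_integrable measurableT) e0.
have close (u v : R) : u <= v -> v < u + d -> `|F v - F u| < e.
  move=> uv vu; rewrite distribution_functionB //.
  rewrite ger0_norm; last by apply: Rintegral_ge0.
  have -> : \int[mu]_(t in `]u, v]) f t = \int[mu]_(t in `]u, v]) `|f t|.
    by apply: eq_Rintegral => t _; rewrite ger0_norm.
  apply: small => //.
  rewrite [X in (X < _)%E](lebesgue_measure_itv `]u, v]) /= lte_fin.
  by case: ifPn => _; rewrite lte_fin //; lra.
apply/nbhs_ballP; exists d => //= y.
rewrite /ball /= ltr_distlC => /andP[dy yd].
have [xy|yx] := leP x y; first by rewrite distrC close.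
by rewrite close ?(ltW yx)//; lra.
Qed.

Lemma distribution_function_gt0 x : 0 < F x -> exists2 u, u <= x & 0 < f u.
Proof.
move=> Fx; apply: contrapT => noex.
suff F0 : F x = 0 by rewrite F0 ltxx in Fx.
rewrite -(@Rintegral_set0 _ _ _ mu f) /distribution_function.
rewrite Rintegral_mkcond [RHS]Rintegral_mkcond; apply: eq_Rintegral => t _.
rewrite !patchE in_set0; case: ifPn => //; rewrite inE /= in_itv /= => tx.
apply/eqP; rewrite eq_le f_ge0 andbT leNgt; apply/negP => ft.
by apply: noex; exists t.
Qed.

Lemma probability_density_opp : probability_density (fun x => f (- x)).
Proof.
case: f_density => mf f0 f1; split => //.
  by apply: (@measurableT_comp _ _ _ _ _ _ f) => //; exact: oppr_measurable.
rewrite -f1 [RHS]ge0_integral_oppr ?preimage_setT //.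
  exact/measurable_EFinP.
by move=> t _; rewrite lee_fin.
Qed.

Lemma distribution_function_opp x :
  distribution_function (fun x => f (- x)) x = 1 - F (- x).
Proof.
rewrite distribution_function_onem.
(* Points are null sets, so the open half-line may be closed; it is then the reflection of []-oo,
   x]]. *)
rewrite Rintegral_itv_obnd_cbnd; last exact: probability_density_integrable.
rewrite /distribution_function /Rintegral [in RHS]ge0_integral_oppr //.
- by rewrite opp_preimage_itvbndy opprK.
- apply: (@measurable_funS _ _ _ _ setT) => //.
  by apply/measurable_EFinP; case: f_density.
- by move=> t _; rewrite lee_fin.
Qed.

End density.

(** * Tools: reflection, convexity from the derivative, a power inequality *)

Lemma s_concave_opp {R : realType} (s : R) (f : R -> R) :
  s_concave s f -> s_concave s (fun x => f (- x)).
Proof.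
have opp_conv (t x y : R) : - (t * x + (1 - t) * y) = t * - x + (1 - t) * - y.
  by rewrite opprD !mulrN.
move=> [fneg fzero fpos]; split.
- by move=> s0 t x y /=; rewrite opp_conv; exact: fneg.
- by move=> s0 t x y /=; rewrite opp_conv; exact: fzero.
- move=> s0; have [cvx cnc] := fpos s0; split.
    move=> x y t; rewrite !inE /= => fx fy.
    have := cvx (- x) (- y) t; rewrite !inE /= /conv /= => /(_ fx fy).
    by rewrite -opp_conv.
  move=> t x y; rewrite !inE /= => fx fy.
  have := cnc t (- x) (- y); rewrite !inE /= /conv /= => /(_ fx fy).
  by rewrite -opp_conv.
Qed.

(** The mean value theorem on both sides of the intermediate point [z] gives two slopes, and the
    left one is at most the right one. *)
Lemma nondecreasing_derive_convex {R : realType} (D : set R) (h h' : R -> R) :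
  is_interval D -> (forall x, D x -> is_derive x 1 h (h' x)) ->
  {in D &, {homo h' : x y / x <= y}} -> @convex_function R R^o D h.
Proof.
move=> itvD dh ndh.
suff below (t : {i01 R}) (x y : R) : D x -> D y -> x < y ->
    h (t%:num * x + (1 - t%:num) * y) <= t%:num * h x + (1 - t%:num) * h y.
  move=> t x y; rewrite !inE => Dx Dy.
  have [xy|yx|->] := ltgtP x y; first exact: below.
    have t1 : 0 <= 1 - t%:num <= 1 by rewrite subr_ge0 gerBl; apply/andP.
    have [t10 t11] := andP t1.
    have := below (Itv01 t10 t11) y x Dy Dx yx => /=.
    by rewrite /conv /= subKr (addrC (_ * y)) (addrC (_ * h y)).
  by rewrite !convmm.
move=> Dx Dy xy; set z := _ + _.
have : 0 <= t%:num by [].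
have : t%:num <= 1 by [].
rewrite {}/z; move: (t%:num) => q q_le1 q_ge0; set z := q * x + _.
have [q0|q0] := eqVneq q 0; first by rewrite /z q0 !mul0r subr0 !mul1r !add0r.
have [q1|q1] := eqVneq q 1; first by rewrite /z q1 subrr !mul0r !mul1r !addr0.
have {q0}q0 : 0 < q by rewrite lt_neqAle eq_sym q0.
have {q1}q1 : q < 1 by rewrite lt_neqAle q1.
have xz : x < z by rewrite /z; nra.
have zy : z < y by rewrite /z; nra.
have Dxy u : x <= u <= y -> D u by move=> xuy; exact: itvD xuy.
have mvt a b : x <= a -> b <= y -> a < b ->
    exists2 c, a < c < b & h b - h a = h' c * (b - a).
  move=> xa by_ ab.
  have dab u : a <= u <= b -> is_derive u 1 h (h' u).
    move=> /andP[au ub]; apply/dh/Dxy.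
    by rewrite (le_trans xa au) (le_trans ub by_).
  have dh_ab u : u \in `]a, b[ -> is_derive u 1 h (h' u).
    by rewrite in_itv /= => /andP[au ub]; apply: dab; rewrite !ltW.
  have ch_ab : {within `[a, b], continuous h}.
    by apply: derivable_within_continuous => u; rewrite in_itv /= => /dab[].
  have [c cab ->] := MVT ab dh_ab ch_ab.
  by exists c => //; rewrite in_itv /= in cab.
have [c /andP[xc cz] hc] := mvt x z (lexx _) (ltW zy) xz.
have [d /andP[zd dy] hd] := mvt z y (ltW xz) (lexx _) zy.
have cd : h' c <= h' d.
  by apply: ndh; rewrite ?inE; [apply: Dxy|apply: Dxy|]; lra.
have zx : z - x = (1 - q) * (y - x) by rewrite /z; ring.
have yz : y - z = q * (y - x) by rewrite /z; ring.
rewrite zx in hc; rewrite yz in hd.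
have -> : h z = h x + h' c * ((1 - q) * (y - x)) by lra.
have : h y = h x + h' c * ((1 - q) * (y - x)) + h' d * (q * (y - x)) by lra.
move=> ->.
(* This product is exactly the height of the chord above the graph at [z]. *)
have : 0 <= (h' d - h' c) * ((1 - q) * q * (y - x)).
  by rewrite mulr_ge0 ?subr_ge0 // mulr_ge0 ?mulr_ge0 //; lra.
lra.
Qed.

(** Here u, v stand for values of the density and a, b for values of F. Since s / (1 + s) = 1 - 1 /
    (1 + s), the exponent q = 1 - p is at least 1 / (1 + s). If u <= v, then v / u <= (b / a) ^ (1 /
    (1 + s)) <= (b / a) ^ q because b / a >= 1; otherwise a ^ q <= b ^ q suffices. *)
Lemma powR_ratio_le {R : realType} (s a b u v p : R) :
  -1 < s -> p <= s / (1 + s) ->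
  0 < a -> a <= b -> 0 < u -> (u <= v -> (v / u) `^ (1 + s) * a <= b) ->
  v * b `^ (p - 1) <= u * a `^ (p - 1).
Proof.
move=> s_gtN1 ps a0 ab u0 key.
have s1 : 0 < 1 + s by rewrite -ltrBlDl sub0r.
have b0 : 0 < b by exact: lt_le_trans ab.
have p1 : (1 + s)^-1 <= 1 - p.
  have : s / (1 + s) = 1 - (1 + s)^-1 by field; rewrite gt_eqF.
  lra.
have p1_ge0 : 0 <= 1 - p by apply: le_trans p1; rewrite invr_ge0 ltW.
rewrite -(opprB 1 p); move: (1 - p) p1 p1_ge0 => q p1 q0 {p ps}.
have aq : 0 < a `^ q by rewrite powR_gt0.
have bq : 0 < b `^ q by rewrite powR_gt0.
rewrite !powRN ler_pdivrMr // mulrAC ler_pdivlMr //.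
have abq : a `^ q <= b `^ q by apply: ge0_ler_powR => //; rewrite nnegrE ltW.
have [uv|vu] := leP u v; last by nra.
set c := v / u.
have c0 : 0 < c by rewrite divr_gt0 // (lt_le_trans u0).
have -> : v = u * c by rewrite mulrC divfK // gt_eqF.
rewrite -mulrA ler_pM2l // -ler_pdivlMr //.
have {}key : c `^ (1 + s) <= b / a by rewrite ler_pdivlMr //; exact: key.
have r1 : 1 <= b / a by rewrite ler_pdivlMr // mul1r.
have -> : b `^ q / a `^ q = (b / a) `^ q.
  rewrite powRM ?invr_ge0 ?(ltW a0) ?(ltW b0) //; congr (_ * _).
  by rewrite -(powR_inv1 (ltW a0)) -powRrM mulN1r powRN.
apply: le_trans (ler_powR r1 p1).
have -> : c = (c `^ (1 + s)) `^ (1 + s)^-1.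
  by rewrite -powRrM divff ?gt_eqF // powRr1 // ltW.
apply: ge0_ler_powR => //; rewrite ?invr_ge0 ?nnegrE ?(ltW s1) ?powR_ge0 //.
by rewrite (le_trans ler01).
Qed.

(** * Monotonicity of f * F ^ (p - 1) *)

Section s_concave_density.
Context {R : realType}.
Local Notation mu := (@lebesgue_measure R).
Variables (s : R) (f : R -> R).
Hypotheses (s_gtN1 : -1 < s) (f_density : probability_density f).
Hypothesis f_sconcave : s_concave s f.
Local Notation F := (distribution_function f).

Let f_ge0 x : 0 <= f x. Proof. by case: f_density. Qed.

(** The factor c ^ (1 + s) is c ^ s, from the slope of the substitution, times c, from the pointwise
    bound on the density. *)
Lemma powR_ratio_distribution_function_le (x y : R) :
  x < y -> 0 < f x -> f x <= f y -> (f y / f x) `^ (1 + s) * F x <= F y.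
Proof.
move=> xy fx fxy; set c := f y / f x.
have c0 : 0 < c by rewrite divr_gt0 // (lt_le_trans fx).
have l0 : 0 < c `^ s by rewrite powR_gt0.
have mf : measurable_fun [set: R] (EFin \o f).
  by apply/measurable_EFinP; case: f_density.
have yE : y = c `^ s * x + (y - c `^ s * x) by rewrite addrC subrK.
have cE : c `^ (1 + s) = c `^ s * c.
  rewrite powRD; last by rewrite (gt_eqF c0) implybT.
  by rewrite powRr1 ?ltW // mulrC.
rewrite -lee_fin EFinM !distribution_functionE //.
have -> : (\int[mu]_(t in `]-oo, y]) (f t)%:E = (c `^ s)%:E *
    \int[mu]_(t in `]-oo, x]) (f (c `^ s * t + (y - c `^ s * x))%R)%:E)%E.
  by rewrite {1}yE [LHS](@ge0_integral_affineNy _ (EFin \o f)) //.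
rewrite cE EFinM -muleA lee_pmul2l ?lte_fin //.
rewrite -ge0_integralZl_EFin ?(ltW c0) //; first last.
- exact: measurable_funS mf.
- by move=> t _; rewrite lee_fin.
apply: ge0_le_integral => //.
- by move=> t _; rewrite -EFinM lee_fin mulr_ge0 // ltW.
- by apply: measurable_funeM; exact: measurable_funS mf.
- apply: (@measurable_funS _ _ _ _ setT) => //.
  apply: (measurableT_comp mf).
  by apply: measurable_funD => //; exact: mulrl_measurable.
move=> t /=; rewrite in_itv /= => tx; rewrite -EFinM lee_fin.
rewrite addrCA -mulrBr; exact: (s_concave_affine_transport f_ge0 f_sconcave).
Qed.

(** There is mass on both sides of [x], hence points u <= x <= - w where [f] is positive;
    s-concavity propagates positivity between them. *)
Lemma s_concave_gt0_Jset x : Jset F x -> 0 < f x.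
Proof.
move=> /andP[F0 F1].
have [u ux fu] := distribution_function_gt0 f_density F0.
have fo := probability_density_opp f_density.
have : 0 < distribution_function (fun x => f (- x)) (- x).
  by rewrite distribution_function_opp // opprK subr_gt0.
move=> /(distribution_function_gt0 fo)[w wx fw].
have [xw|wNx] := ltP u (- w).
  have uxw : u <= x <= - w by rewrite ux /=; lra.
  by have [] := s_concave_chord f_ge0 f_sconcave uxw xw fu fw.
by have -> : x = u by lra.
Qed.

Lemma density_powR_distribution_function_le (p x y : R) :
  p <= s / (1 + s) -> x <= y -> 0 < f x -> 0 < F x ->
  f y * F y `^ (p - 1) <= f x * F x `^ (p - 1).
Proof.
move=> ps; rewrite le_eqVlt => /predU1P[->//|xy] fx Fx.
apply: (powR_ratio_le s_gtN1) => //.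
- by apply: nondecreasing_distribution_function => //; exact: ltW.
- exact: powR_ratio_distribution_function_le.
Qed.

End s_concave_density.

(** * Powers and generators of a function: continuity and derivative *)

Lemma continuous_powR_comp {R : realType} (g : R -> R) (q x : R) :
  {for x, continuous g} -> 0 < g x -> {for x, continuous (fun u => g u `^ q)}.
Proof.
move=> cg gx.
have cq : {for g x, continuous (fun y => y `^ q)}.
  apply/differentiable_continuous/derivable1_diffP.
  by case: (is_derive1_powR q gx).
exact: (@continuous_comp R R R g (fun y => y `^ q) x cg cq).
Qed.

(** The sign in the generator turns the factor p into |p|, so for every p the monotonicity of the
    derivative is governed by dg * g ^ (p - 1) alone. *)
Lemma is_derive_generator_comp {R : realType} (p x dg : R) (g : R -> R) :
  0 < g x -> is_derive x 1 g dg ->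
  is_derive x 1 (fun u => generator p (g u))
    (- ((if p == 0 then 1 else `|p|) * (dg * g x `^ (p - 1)))).
Proof.
move=> gx dgx; rewrite /generator; case: eqVneq => [->|p0].
  rewrite sub0r powR_inv1 ?(ltW gx) // mul1r mulrC.
  apply: is_deriveN.
  exact: (@is_derive1_comp _ (@ln R) g x _ _ (is_derive1_ln gx) dgx).
rewrite normrEsg [X in - X](_ : _ =
  Num.sg p *: (p * g x `^ (p - 1) * dg)); last by rewrite /GRing.scale /=; ring.
apply: is_deriveN; apply: is_deriveZ.
exact: (@is_derive1_comp _ (fun y => y `^ p) g x _ _
  (is_derive1_powR p gx) dgx).
Qed.

(** * Continuity of f on J(F), F' = f, and convexity of the generators *)

Section bi_s_concavity.
Context {R : realType}.
Local Notation mu := (@lebesgue_measure R).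
Variables (s : R) (f : R -> R).
Hypotheses (s_gtN1 : -1 < s) (f_density : probability_density f).
Hypothesis f_sconcave : s_concave s f.
Local Notation F := (distribution_function f).

(** The reflected density has distribution function 1 - F (- x), so this is the monotonicity for F
    read at - y <= - x. *)
Lemma density_powR_onem_distribution_function_le (p x y : R) :
  p <= s / (1 + s) -> x <= y -> 0 < f y -> 0 < 1 - F y ->
  f x * (1 - F x) `^ (p - 1) <= f y * (1 - F y) `^ (p - 1).
Proof.
move=> ps xy fy Gy.
have := @density_powR_distribution_function_le _ s (fun x => f (- x)) s_gtN1
  (probability_density_opp f_density) (s_concave_opp f_sconcave)
  p (- y) (- x) ps.
rewrite lerN2 !(distribution_function_opp f_density) /= !opprK => /(_ xy fy Gy).
by [].
Qed.

Lemma s_concave_density_continuous x : Jset F x -> {for x, continuous f}.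
Proof.
move=> Jx; have fx := s_concave_gt0_Jset f_density f_sconcave Jx.
move/andP: (Jx) => [Fx0]; rewrite -subr_gt0 => Gx0.
pose p := s / (1 + s).
(* The bounds on [f u] obtained by solving the two monotonicities for it; both tend to [f x] because
   F is continuous. *)
pose a u := f x * F x `^ (p - 1) * F u `^ (1 - p).
pose b u := f x * (1 - F x) `^ (p - 1) * (1 - F u) `^ (1 - p).
have cF : {for x, continuous F}.
  exact: (continuous_distribution_function f_density).
have cG : {for x, continuous (fun u => 1 - F u)}.
  by apply: cvgB => //; exact: cvg_cst.
have powK y : 0 < y -> y `^ (p - 1) * y `^ (1 - p) = 1.
  move=> y0; rewrite -powRD; last by rewrite (gt_eqF y0) implybT.
  by rewrite addrA subrK subrr powRr0.
have ax : a u @[u --> x] --> f x.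
  have -> : f x = a x by rewrite /a -mulrA powK // mulr1.
  apply: cvgMr; exact: (continuous_powR_comp cF).
have bx : b u @[u --> x] --> f x.
  have -> : f x = b x by rewrite /b -mulrA powK // mulr1.
  apply: cvgMr; exact: (continuous_powR_comp cG).
apply/cvgrPdist_lt => e e0; near=> u.
have Fu0 : 0 < F u by near: u; exact: (cvgr_gt (F x)).
have Gu0 : 0 < 1 - F u by near: u; exact: (cvgr_gt (1 - F x)).
have fu : 0 < f u.
  apply: (s_concave_gt0_Jset f_density f_sconcave).
  by apply/andP; rewrite -(subr_gt0 _ 1).
have : `|f x - a u| < e by near: u; move/cvgrPdist_lt : ax; exact.
have : `|f x - b u| < e by near: u; move/cvgrPdist_lt : bx; exact.
have solve k z c : 0 < z -> (k * z `^ (p - 1) <= c) = (k <= c * z `^ (1 - p)).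
  move=> z0; rewrite -[LHS](ler_pM2r (powR_gt0 (1 - p) z0)) -mulrA powK //.
  by rewrite mulr1.
have solve' k z c : 0 < z -> (c <= k * z `^ (p - 1)) = (c * z `^ (1 - p) <= k).
  move=> z0; rewrite -[LHS](ler_pM2r (powR_gt0 (1 - p) z0)) -(mulrA k) powK //.
  by rewrite mulr1.
have leF :=
  @density_powR_distribution_function_le _ s f s_gtN1 f_density f_sconcave p.
have leG := @density_powR_onem_distribution_function_le p.
(* To the right of [x], b u <= f u <= a u; to the left the two bounds exchange roles. *)
have [xu|ux] := leP x u.
  have := leF x u (lexx _) xu fx Fx0; rewrite solve //.
  have := leG x u (lexx _) xu fu Gu0; rewrite solve' //.
  by rewrite -/(a u) -/(b u) !ltr_distlC => ? ? /andP[? ?] /andP[? ?]; lra.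
have := leF u x (lexx _) (ltW ux) fu Fu0; rewrite solve' //.
have := leG u x (lexx _) (ltW ux) fx Gx0; rewrite solve //.
by rewrite -/(a u) -/(b u) !ltr_distlC => ? ? /andP[? ?] /andP[? ?]; lra.
Unshelve. all: by end_near. Qed.

Lemma is_derive_distribution_function x : Jset F x -> is_derive x 1 F (f x).
Proof.
move=> Jx.
(* The endpoint [x + 1] only serves to make [x] interior for the fundamental theorem of calculus. *)
have intf : mu.-integrable `]-oo, (x + 1)] (EFin \o f).
  exact: probability_density_integrable.
have xx1 : x < x + 1 by rewrite ltrDl.
have [dF F'] := @continuous_FTC1 _ f -oo%O x (x + 1) xx1 intf (ltNyr x)
  (s_concave_density_continuous Jx).
by apply: (DeriveDef dF); rewrite -derive1E; exact: F'.
Qed.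

Lemma is_interval_Jset : is_interval (Jset F).
Proof.
move=> x y /andP[x0 _] /andP[_ y1] z /andP[xz zy]; apply/andP; split.
  by rewrite (lt_le_trans x0) // nondecreasing_distribution_function.
by rewrite (le_lt_trans _ y1) // nondecreasing_distribution_function.
Qed.

(** The derivatives are -k * f * F ^ (p - 1) and, the derivative of 1 - F being -f, k * f * (1 - F)
    ^ (p - 1); both are nondecreasing on J(F). *)
Lemma convex_generator_distribution_function (p : R) : p <= s / (1 + s) ->
  @convex_function R R^o (Jset F) (fun x => generator p (F x)) /\
  @convex_function R R^o (Jset F) (fun x => generator p (1 - F x)).
Proof.
move=> ps; set k := if p == 0 then 1 else `|p|.
have k0 : 0 <= k by rewrite /k; case: ifP.
have fJ := s_concave_gt0_Jset f_density f_sconcave.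
split.
- apply: (nondecreasing_derive_convex
    (h' := fun x => - (k * (f x * F x `^ (p - 1))))).
  + exact: is_interval_Jset.
  + move=> x Jx; apply: is_derive_generator_comp; first by case/andP: Jx.
    exact: is_derive_distribution_function.
  + move=> x y; rewrite !inE => Jx Jy xy.
    rewrite lerN2; apply: (ler_wpM2l k0).
    apply: (density_powR_distribution_function_le s_gtN1 f_density f_sconcave)
      => //.
      exact: fJ.
    by case/andP: Jx.
- apply: (nondecreasing_derive_convex
    (h' := fun x => k * (f x * (1 - F x) `^ (p - 1)))).
  + exact: is_interval_Jset.
  + move=> x Jx; have Gx : 0 < 1 - F x by case/andP: Jx; rewrite subr_gt0.
    have dG : is_derive x 1 (fun u => 1 - F u) (- f x).
      rewrite -sub0r; apply: is_deriveB.
      exact: is_derive_distribution_function.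
    apply: is_derive_eq.
      exact: (@is_derive_generator_comp _ p x (- f x) (fun u => 1 - F u)).
    by rewrite -/k; move: (_ `^ _) => w; rewrite mulNr mulrN opprK.
  + move=> x y; rewrite !inE => Jx Jy xy; apply: (ler_wpM2l k0).
    apply: (density_powR_onem_distribution_function_le ps) => //.
      exact: fJ.
    by case/andP: Jy; rewrite subr_gt0.
Qed.

End bi_s_concavity.

Theorem proposition1 (R : realType) (s : R) (s_gtN1 : -1 < s)
    (f : R -> R) (f_density : probability_density f) (f_sconcave : s_concave s f)
    (sstar : R) (sstar_le : sstar <= s / (1 + s)) :
  bi_s_concave sstar (distribution_function f).
Proof.
have [cvxF cvxG] :=
  convex_generator_distribution_function s_gtN1 f_density f_sconcave sstar_le.
split.
- exact: continuous_distribution_function.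
(* In each regime the generator is the function to be shown convex, or the opposite of the one to be
   shown concave. *)
- move=> p0; have genE y : generator sstar y = y `^ sstar.
    by rewrite /generator lt_eqF // ltr0_sg // mulN1r opprK.
  by split => t x y Jx Jy; [have := cvxF t x y Jx Jy|have := cvxG t x y Jx Jy];
    rewrite !genE.
- move=> p0; have genE y : generator sstar y = - ln y.
    by rewrite /generator p0 eqxx.
  by split => t x y Jx Jy; [have := cvxF t x y Jx Jy|have := cvxG t x y Jx Jy];
    rewrite !genE.
- move=> p0; have genE y : generator sstar y = - y `^ sstar.
    by rewrite /generator gt_eqF // gtr0_sg // mul1r.
  by split => t x y Jx Jy; [have := cvxF t x y Jx Jy|have := cvxG t x y Jx Jy];
    rewrite !genE.
Qed.
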